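(* Let $X$ be a separable $L$-embedded real Banach space with the Daugavet property and let $Y$ be a non-zero real Banach space. If either $X^{**}$ or $Y$ has the metric approximation property, then the projective tensor product $X\widehat{\otimes}_\pi Y$ has the Daugavet property.
   Context: All Banach spaces are real. A Banach space $X$ has the Daugavet property if every bounded rank-one operator $T:X\to X$ satisfies $\|T+I\|=1+\|T\|$, where $I$ is the identity operator. A Banach space $X$ is $L$-embedded if there is a subspace $Z$ of $X^{**}$ such that $X^{**}=X\oplus_1 Z$ (i.e. $X^{**}$ is the direct sum of $X$ and $Z$ and $\|x+z\|=\|x\|+\|z\|$ for all $x\in X$, $z\in Z$), where $X$ is canonically embedded in $X^{**}$. $X\widehat{\otimes}_\pi Y$ denotes the (completed) projective tensor product. A Banach space $E$ has the metric approximation property if there exists a net $(S_\alpha)$ of finite-rank operators $S_\alpha:E\to E$ with $\|S_\alpha\|\le 1$ such that $S_\alpha(e)\to e$ for every $e\in E$. *)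

(* Defs.v *)
From HB Require Import structures.
From mathcomp Require Import all_boot all_order all_algebra.
From mathcomp Require Import all_classical all_reals all_analysis.
Set Implicit Arguments.
Unset Strict Implicit.
Unset Printing Implicit Defensive.
Import Order.TTheory GRing.Theory Num.Theory.
Import numFieldNormedType.Exports.
Local Open Scope classical_set_scope.
Local Open Scope ring_scope.

Section BoundedOperators.
Variables (R : realType) (E F : normedModType R).

Definition is_blin : {pred E -> F} :=
  fun f => `[< linear f /\ bounded_fun_norm f >].

Lemma is_blinP (f : E -> F) :
  reflect (linear f /\ bounded_fun_norm f) (f \in is_blin).
Proof. exact: asboolP. Qed.

Lemma is_blin_submod : submod_closed is_blin.
Proof.
split.
  apply/is_blinP; split=> [a x y|r]; first by rewrite /= scaler0 addr0.
  by exists 0 => x _; rewrite normr0.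
move=> a f g /is_blinP[lf bf] /is_blinP[lg bg]; apply/is_blinP; split.
  move=> k x y; rewrite !fctE /= lf lg !scalerDr !scalerA (mulrC a k).
  by rewrite addrACA.
move=> r; have [M fM] := bf r; have [N gN] := bg r.
exists (`|a| * M + N) => x xr; rewrite !fctE.
apply: (le_trans (ler_normD _ _)); apply: lerD; last exact: gN.
by rewrite normrZ ler_wpM2l //; exact: fM.
Qed.

HB.instance Definition _ :=
  GRing.isSubmodClosed.Build R (E -> F) is_blin is_blin_submod.

Record blin := Blin { blin_fun :> E -> F ; _ : blin_fun \in is_blin }.

HB.instance Definition _ := [isSub for blin_fun].
HB.instance Definition _ := [Choice of blin by <:].
HB.instance Definition _ := [SubChoice_isSubLmodule of blin by <:].

Lemma blin_linear (f : blin) : linear f.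
Proof. by case: f => f /= /is_blinP[]. Qed.

HB.instance Definition _ (f : blin) :=
  GRing.isLinear.Build R E F *:%R (blin_fun f) (blin_linear f).

Lemma blin_bounded (f : blin) : bounded_fun_norm f.
Proof. by case: f => f /= /is_blinP[]. Qed.

Definition opnorm (f : blin) : R := sup [set `|f x| | x in [set x | `|x| <= 1]].

Lemma opnorm_has_sup (f : blin) :
  has_sup [set `|f x| | x in [set x | `|x| <= 1]].
Proof.
split; first by exists `|f 0|, 0 => //=; rewrite normr0.
have [M fM] := blin_bounded f 1.
by exists M => _ [x x1 <-]; exact: fM.
Qed.

Lemma opnorm_ub (f : blin) x : `|x| <= 1 -> `|f x| <= opnorm f.
Proof.
by move=> x1; apply: (ub_le_sup (opnorm_has_sup f).2); exists x.
Qed.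

Lemma opnorm_le (f : blin) M :
  (forall x, `|x| <= 1 -> `|f x| <= M) -> opnorm f <= M.
Proof.
move=> fM; apply: ge_sup; first exact: (opnorm_has_sup f).1.
by move=> _ [x x1 <-]; exact: fM.
Qed.

Lemma opnorm_bound (f : blin) x : `|f x| <= opnorm f * `|x|.
Proof.
have [->|x0] := eqVneq x 0; first by rewrite linear0 !normr0 mulr0.
have nx : 0 < `|x| by rewrite normr_gt0.
have := @opnorm_ub f (`|x|^-1 *: x).
rewrite linearZ /= !normrZ normfV normr_id mulVf ?gt_eqF // => /(_ (lexx _)).
by rewrite mulrC ler_pdivrMr.
Qed.

Lemma opnormD (f g : blin) : opnorm (f + g) <= opnorm f + opnorm g.
Proof.
apply: opnorm_le => x x1; apply: (le_trans (ler_normD _ _)).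
by apply: lerD; exact: opnorm_ub.
Qed.

Lemma opnormZ_le (a : R) (f : blin) : opnorm (a *: f) <= `|a| * opnorm f.
Proof.
apply: opnorm_le => x x1; rewrite normrZ.
by apply: ler_wpM2l => //; exact: opnorm_ub.
Qed.

Lemma opnormZ (a : R) (f : blin) : opnorm (a *: f) = `|a| * opnorm f.
Proof.
apply/eqP; rewrite eq_le opnormZ_le /=.
have [->|a0] := eqVneq a 0.
  rewrite normr0 mul0r; apply: (@le_trans _ _ `|(0 *: f : blin) 0|).
    exact: normr_ge0.
  by apply: opnorm_ub; rewrite normr0.
have na : 0 < `|a| by rewrite normr_gt0.
have := opnormZ_le a^-1 (a *: f).
by rewrite scalerA mulVf // scale1r normfV ler_pdivlMl.
Qed.

Lemma opnorm_eq0 (f : blin) : opnorm f = 0 -> f = 0.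
Proof.
move=> f0; apply/val_inj/funext => x /=.
apply/eqP; rewrite -normr_le0; apply: (le_trans (opnorm_bound f x)).
by rewrite f0 mul0r.
Qed.

HB.instance Definition _ :=
  Lmodule_isNormed.Build R blin opnormD opnormZ opnorm_eq0.

End BoundedOperators.

Section Identity.
Variables (R : realType) (E : normedModType R).

Lemma is_blin_id : (id : E -> E) \in @is_blin R E E.
Proof. by apply/is_blinP; split=> // r; exists r. Qed.

Definition blin_id : blin E E := Blin is_blin_id.

End Identity.
Arguments blin_id {R} E.

Definition dual (R : realType) (E : normedModType R) : normedModType R :=
  blin E R^o.

Definition bidual (R : realType) (E : normedModType R) : normedModType R :=
  dual (dual E).

Section CanonicalEmbedding.
Variables (R : realType) (E : normedModType R).

Lemma is_blin_eval (x : E) :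
  (fun f : blin E R^o => f x) \in @is_blin R (dual E) R^o.
Proof.
apply/is_blinP; split=> // r; exists (r * `|x|) => f fr.
by apply: (le_trans (opnorm_bound f x)); apply: ler_wpM2r.
Qed.

Definition bidual_embedding (x : E) : bidual E := Blin (is_blin_eval x).

End CanonicalEmbedding.

Section Properties.
Variable R : realType.

Definition separable (E : normedModType R) :=
  exists2 D : set E, countable D & dense D.

Definition rank_one (E F : normedModType R) (T : blin E F) :=
  exists2 v : F, v != 0 & range T = [set a *: v | a in [set: R]].

Definition finite_rank (E F : normedModType R) (T : blin E F) :=
  exists n (v : 'I_n -> F),
    forall x, exists c : 'I_n -> R, T x = \sum_(i < n) c i *: v i.

Definition daugavet (E : normedModType R) :=
  forall T : blin E E, rank_one T -> `|T + blin_id E| = 1 + `|T|.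

Definition L_embedded (E : normedModType R) :=
  exists Z : {pred bidual E},
    [/\ submod_closed Z,
        forall u, exists x z, z \in Z /\ u = bidual_embedding x + z,
        forall x, bidual_embedding x \in Z -> bidual_embedding x = 0 &
        forall x z, z \in Z -> `|bidual_embedding x + z| = `|x| + `|z|].

Definition directed (A : Type) (le : A -> A -> Prop) :=
  [/\ inhabited A, forall a, le a a,
      forall a b c, le a b -> le b c -> le a c &
      forall a b, exists2 c, le a c & le b c].

Definition tails (A : Type) (le : A -> A -> Prop) : set_system A :=
  filter_from [set: A] (fun a => [set b | le a b]).

Definition metric_approximation_property (E : normedModType R) :=
  exists (A : Type) (le : A -> A -> Prop) (S : A -> blin E E),
    [/\ directed le,
        forall a, finite_rank (S a),
        forall a, `|S a| <= 1 &
        forall e, S a e @[a --> tails le] --> e].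

End Properties.

Section ProjectiveTensorProduct.
Variables (R : realType) (X Y : normedModType R).

Definition bilinear_map (V : lmodType R) (b : X -> Y -> V) :=
  (forall y, linear (b^~ y)) /\ (forall x, linear (b x)).

(* A sequence s represents the tensor \sum_(p <- s) p.1 (x) p.2 of the
   algebraic tensor product of X and Y; two sequences represent the same tensor
   when every (not necessarily bounded) bilinear form agrees on them. *)
Definition tensor_eq (s s' : seq (X * Y)) :=
  forall b : X -> Y -> R^o, bilinear_map b ->
    \sum_(p <- s) b p.1 p.2 = \sum_(p <- s') b p.1 p.2.

Definition projective_norm (s : seq (X * Y)) : R :=
  inf [set \sum_(p <- s') `|p.1| * `|p.2| | s' in [set s' | tensor_eq s s']].

(* P, together with the map (x, y) |-> x (x) y given by t, is a completion of
   the algebraic tensor product normed by the projective norm. *)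
Definition is_projective_tensor_product
    (P : completeNormedModType R) (t : X -> Y -> P) :=
  [/\ bilinear_map t,
      forall s : seq (X * Y), `|\sum_(p <- s) t p.1 p.2| = projective_norm s &
      dense (range (fun s : seq (X * Y) => \sum_(p <- s) t p.1 p.2))].

End ProjectiveTensorProduct.

(* Main.v *)
(* The separable Daugavet space X has nested slices, contained in any given
   slice S of its ball, whose points are almost L-orthogonal to the successive
   terms of a dense sequence.  Points y_n of these slices converge weak* along
   an ultrafilter to some z in the ball of X** with |x + z| = |x| + 1 for all x
   in X, and L-embeddedness forces z into the summand Z, where
   X** = X (+)_1 Z.

   A slice of the unit ball of the projective tensor product contains some
   x0 (x) y0; take S to be the slice of X that F(. (x) y0) defines.  On X** x Y
   consider B(x + z', y) = G(x (x) y) + z'(f) g(y), where G norms a given tensor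
   p, and f, g are F(. (x) y0), F(x0 (x) .) up to a scalar.  The l_1-sum makes B
   contractive, and B(p) + B(z, y0) is almost |p| + 1.  The approximation
   property of X** or Y replaces B by a contractive form of finite type.  For
   such forms weak* limits can be taken inside X** (x) Y: if |p + y_n (x) y0| < c
   for all n, then a representation of p + y_n (x) y0 can be rewritten, up to a
   small error, with second factors in a finite set independent of n, and the
   first factors have weak* limits; hence B(p) + B(z, y0) <= c.  So some
   y_n (x) y0 is a point of the slice almost L-orthogonal to p. *)

Require Import Defs.
From HB Require Import structures.
From mathcomp Require Import all_boot all_order all_algebra.
From mathcomp Require Import all_classical all_reals all_analysis.
From mathcomp Require Import ring lra.
Set Implicit Arguments.
Unset Strict Implicit.
Unset Printing Implicit Defensive.
Import Order.TTheory GRing.Theory Num.Theory.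
Import numFieldNormedType.Exports.
Local Open Scope classical_set_scope.
Local Open Scope ring_scope.

(** * Norming functionals *)

Section HahnBanach.
Variables (R : realType) (E : normedModType R).

(** Homogeneity is only an inequality for [t > 0], which passes easily to infima; using it with
    [t^-1] recovers equality. *)
Definition norm_sublinear (p : E -> R) :=
  [/\ forall x y, p (x + y) <= p x + p y,
      forall t x, 0 < t -> p (t *: x) <= t * p x &
      forall x, p x <= `|x|].

Lemma norm_sublinear_norm : norm_sublinear (fun x : E => `|x|).
Proof.
split=> [x y|t x t0|//]; first exact: ler_normD.
by rewrite normrZ gtr0_norm.
Qed.

Lemma norm_sublinear0 p : norm_sublinear p -> p 0 = 0.
Proof.
move=> [pD _ pn]; apply/le_anti/andP; split.
  by rewrite (le_trans (pn 0)) ?normr0.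
by have := pD 0 0; rewrite addr0 lerDl.
Qed.

Lemma norm_sublinear_geN p x : norm_sublinear p -> - `|x| <= p x.
Proof.
move=> sp; have [pD _ pn] := sp; have := pD x (- x).
rewrite subrr norm_sublinear0 // => h; have := pn (- x); rewrite normrN.
by lra.
Qed.

Lemma norm_sublinear_chain (A : set (E -> R)) :
  A !=set0 -> (forall p, A p -> norm_sublinear p) ->
  (forall p q, A p -> A q -> (forall x, p x <= q x) \/ (forall x, q x <= p x)) ->
  norm_sublinear (fun x => inf [set p x | p in A]).
Proof.
move=> [p0 Ap0] As Atot.
have lbA x : has_lbound [set p x | p in A].
  by exists (- `|x|) => _ [p /As sp <-]; exact: norm_sublinear_geN.
have neA x : [set p x | p in A] !=set0 by exists (p0 x), p0.
have infA p x : A p -> inf [set p x | p in A] <= p x.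
  by move=> Ap; apply: ge_inf => //; exists p.
split=> [x y|t x t0|x].
- rewrite -lerBlDr; apply: lb_le_inf => // _ [p Ap <-].
  rewrite lerBlDr -lerBlDl; apply: lb_le_inf => // _ [q Aq <-].
  rewrite lerBlDl; have [pD _ _] := As _ Ap; have [qD _ _] := As _ Aq.
  (* The smaller of [p] and [q] serves at both points; this is where the chain condition enters. *)
  have [pq|qp] := Atot _ _ Ap Aq.
    by rewrite (le_trans (infA _ _ Ap))// (le_trans (pD _ _))// lerD.
  by rewrite (le_trans (infA _ _ Aq))// (le_trans (qD _ _))// lerD.
- rewrite -ler_pdivrMl//; apply: lb_le_inf => // _ [p Ap <-].
  rewrite ler_pdivrMl// (le_trans (infA _ _ Ap))//.
  by have [_ + _] := As _ Ap; exact.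
- by rewrite (le_trans (infA _ _ Ap0))//; have [_ _ +] := As _ Ap0; exact.
Qed.

Definition descend (p : E -> R) y x :=
  inf [set p (x + t *: y) - t * p y | t in [set t | 0 <= t]].

Lemma descend_lbound p y x : norm_sublinear p ->
  has_lbound [set p (x + t *: y) - t * p y | t in [set t | 0 <= t]].
Proof.
move=> sp; have [pD pZ _] := sp; exists (- p (- x)) => _ [t /= t0 <-].
have [->|tn0] := eqVneq t 0.
  rewrite scale0r addr0 mul0r subr0; have := pD x (- x).
  by rewrite subrr norm_sublinear0//; lra.
have {tn0}t0 : 0 < t by rewrite lt_neqAle eq_sym tn0.
have : t * p y <= p (t *: y).
  rewrite -ler_pdivlMl//; have := pZ t^-1 (t *: y); rewrite invr_gt0.
  by rewrite scalerA mulVf ?gt_eqF// scale1r; exact.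
by have := pD (x + t *: y) (- x); rewrite addrC addKr; lra.
Qed.

Lemma descend_le p y x t : norm_sublinear p -> 0 <= t ->
  descend p y x <= p (x + t *: y) - t * p y.
Proof.
by move=> sp t0; apply: ge_inf; [exact: descend_lbound|exists t].
Qed.

Lemma descend_ge p y x c :
  (forall t, 0 <= t -> c <= p (x + t *: y) - t * p y) -> c <= descend p y x.
Proof.
move=> h; apply: lb_le_inf; last by move=> _ [t t0 <-]; exact: h.
by exists (p (x + 0 *: y) - 0 * p y), 0 => /=.
Qed.

Lemma descend_le_self p y x : norm_sublinear p -> descend p y x <= p x.
Proof.
move=> sp; have := @descend_le p y x 0 sp (lexx _).
by rewrite scale0r addr0 mul0r subr0.
Qed.

Lemma descendN p y : norm_sublinear p -> descend p y (- y) <= - p y.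
Proof.
move=> sp; have := @descend_le p y (- y) 1 sp ler01.
by rewrite scale1r addNr norm_sublinear0// mul1r sub0r.
Qed.

Lemma descend_sublinear p y :
  norm_sublinear p -> norm_sublinear (descend p y).
Proof.
move=> sp; have [pD pZ pn] := sp; split=> [x x'|t x t0|x].
- rewrite -lerBlDr; apply: descend_ge => t t0.
  rewrite lerBlDr -lerBlDl; apply: descend_ge => s s0.
  rewrite lerBlDl (le_trans (@descend_le _ y _ (t + s) sp _)) ?addr_ge0//.
  have := pD (x + t *: y) (x' + s *: y).
  by rewrite addrACA -scalerDl; lra.
- rewrite -ler_pdivrMl//; apply: descend_ge => s s0.
  rewrite ler_pdivrMl//.
  have ts : 0 <= t * s by rewrite mulr_ge0// ltW.
  apply: (le_trans (@descend_le _ y _ _ sp ts)).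
  have := pZ t (x + s *: y) t0; rewrite scalerDr scalerA; lra.
- exact: le_trans (descend_le_self _ _ sp) (pn x).
Qed.

(* Zorn's lemma; below, minimality is tested against [descend p y], and makes
   [p] odd, hence linear. *)
Lemma minimal_norm_sublinear p0 : norm_sublinear p0 ->
  exists p, [/\ norm_sublinear p, forall x, p x <= p0 x &
    forall q, norm_sublinear q -> (forall x, q x <= p x) -> q = p].
Proof.
move=> sp0.
pose Q p := norm_sublinear p /\ forall x, p x <= p0 x.
pose T := {p | Q p}.
(* The order is reversed, so that a maximal element for [le] is a minimal functional. *)
pose le (p q : T) := `[< forall x, sval q x <= sval p x >].
have [|||A Atot|[p [sp pp0]] pmin] := @Zorn T le.
- by move=> p; apply/asboolP.
- move=> p q r /asboolP pq /asboolP qr; apply/asboolP => x.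
  exact: le_trans (qr x) (pq x).
- move=> [p hp] [q hq] /asboolP /= pq /asboolP /= qp; apply: eq_exist.
  by apply/funext => x; apply/le_anti; rewrite pq qp.
(* The empty chain has no usable infimum; [p0] itself bounds it. *)
- have [[a Aa]|A0] := pselect (A !=set0); last first.
    have hp0 : Q p0 by [].
    by exists (exist Q p0 hp0) => s As; exfalso; apply: A0; exists s.
  pose A' := [set sval s | s in A].
  have A's p : A' p -> norm_sublinear p by move=> [[q []] ? ? ? <-].
  have sA' : norm_sublinear (fun x => inf [set p x | p in A']).
    apply: norm_sublinear_chain => //; first by exists (sval a), a.
    move=> _ _ [p Ap <-] [q Aq <-].
    by have [/asboolP|/asboolP] := Atot _ _ Ap Aq; [right|left].
  have lA' s x : A s -> inf [set p x | p in A'] <= sval s x.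
    move=> As; apply: ge_inf; last by exists (sval s) => //; exists s.
    by exists (- `|x|) => _ [p /A's sp <-]; exact: norm_sublinear_geN.
  have A'p0 x : inf [set p x | p in A'] <= p0 x.
    exact: le_trans (lA' _ _ Aa) ((svalP a).2 x).
  exists (exist Q _ (conj sA' A'p0)) => s As.
  by apply/asboolP => x; exact: lA'.
- exists p; split=> // q sq qp.
  have qp0 x : q x <= p0 x by exact: le_trans (qp x) (pp0 x).
  have := pmin (exist Q _ (conj sq qp0)).
  by move=> /(_ (introT (asboolP _) qp)) [].
Qed.

(** Minimization starts from [descend v] of the norm instead of the norm: then [p (- v) <= - |v|],
    and oddness of the minimal [p] yields [p v = |v|]. *)
Lemma norming_functional (v : E) :
  exists F : dual E, `|F| <= 1 /\ F v = `|v|.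
Proof.
have [p [sp pv pmin]] :=
  minimal_norm_sublinear (descend_sublinear v norm_sublinear_norm).
have [pD pZ pn] := sp.
have pN x : p (- x) = - p x.
  apply/le_anti/andP; split.
    rewrite -{1}(pmin _ (descend_sublinear x sp)) ?descendN// => z.
    exact: descend_le_self.
  by have := pD x (- x); rewrite subrr norm_sublinear0//; lra.
have pA x y : p (x + y) = p x + p y.
  apply/le_anti; rewrite pD /=; have := pD (x + y) (- y).
  by rewrite addrK pN; lra.
have pS t x : p (t *: x) = t * p x.
  have pos s z : 0 < s -> p (s *: z) = s * p z.
    move=> s0; apply/le_anti; rewrite pZ//= -ler_pdivlMl//.
    have := pZ s^-1 (s *: z); rewrite invr_gt0.
    by rewrite scalerA mulVf ?gt_eqF// scale1r; exact.
  have [t0|t0|->] := ltrgt0P t; first exact: pos.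
    rewrite -[t]opprK scaleNr pN pos ?mulNr//; lra.
  by rewrite scale0r mul0r norm_sublinear0.
have pb : (p : E -> R^o) \in @is_blin R E R^o.
  apply/is_blinP; split=> [a x y|r]; first by rewrite pA pS.
  exists r => x xr; rewrite (le_trans _ xr)// ler_norml pn andbT.
  exact: norm_sublinear_geN.
exists (Blin pb); split.
  apply: opnorm_le => x x1 /=; rewrite (le_trans _ x1)// ler_norml pn andbT.
  exact: norm_sublinear_geN.
apply/le_anti; rewrite /= pn /= -[p v]opprK -pN lerNr.
exact: le_trans (pv _) (descendN _ norm_sublinear_norm).
Qed.

End HahnBanach.

(** * Bounded operators and ultrafilter limits *)

Section BoundedMaps.
Variable R : realType.

Lemma blin_of_bound (E F : normedModType R) (f : E -> F) (M : R) :
  linear f -> 0 <= M -> (forall x, `|f x| <= M * `|x|) ->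
  exists2 T : blin E F, (forall x, T x = f x) & `|T| <= M.
Proof.
move=> lf M0 fM.
have bf : f \in @is_blin R E F.
  apply/is_blinP; split=> // r; exists (M * r) => x xr.
  by rewrite (le_trans (fM x))// ler_wpM2l.
exists (Blin bf) => //; apply: opnorm_le => x x1 /=.
by rewrite (le_trans (fM x))// ler_piMr.
Qed.

Lemma blin_ext (E F : normedModType R) (f g : blin E F) :
  (forall x, f x = g x) -> f = g.
Proof. by move=> fg; apply/val_inj/funext. Qed.

Lemma blinD (E F : normedModType R) (f g : blin E F) x : (f + g) x = f x + g x.
Proof. by []. Qed.

Lemma blinZ (E F : normedModType R) k (f : blin E F) x : (k *: f) x = k *: f x.
Proof. by []. Qed.

Lemma functionalZ (E : normedModType R) (f : dual E) k x : f (k *: x) = k * f x.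
Proof. exact: linearZ. Qed.

Lemma functionalD (E : normedModType R) (f : dual E) x y : f (x + y) = f x + f y.
Proof. exact: linearD. Qed.

Lemma functionalB (E : normedModType R) (f : dual E) x y : f (x - y) = f x - f y.
Proof. exact: linearB. Qed.

Lemma functional_sum (E : normedModType R) (f : dual E) I (r : seq I) (P : pred I)
    (F : I -> E) :
  f (\sum_(i <- r | P i) F i) = \sum_(i <- r | P i) f (F i).
Proof. exact: linear_sum. Qed.

Lemma dualD (E : normedModType R) (f g : dual E) x : (f + g) x = f x + g x.
Proof. by []. Qed.

Lemma dualB (E : normedModType R) (f g : dual E) x : (f - g) x = f x - g x.
Proof. by []. Qed.

Lemma dual_sum (E : normedModType R) I (r : seq I) (P : pred I)
    (f : I -> dual E) x :
  (\sum_(i <- r | P i) f i) x = \sum_(i <- r | P i) f i x.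
Proof. by elim/big_rec2: _ => // i a b _ <-. Qed.

Lemma dualZ (E : normedModType R) k (f : dual E) x : (k *: f) x = k * f x.
Proof. by []. Qed.

Lemma blin_norm_le (E F : normedModType R) (f : blin E F) x :
  `|f x| <= `|f| * `|x|.
Proof. exact: opnorm_bound. Qed.

Lemma functional_le (E : normedModType R) (f : dual E) x :
  f x <= `|f| * `|x|.
Proof. exact: le_trans (ler_norm _) (blin_norm_le f x). Qed.

Lemma blin_norm_approx (E F : normedModType R) (f : blin E F) e : 0 < e ->
  exists2 x, `|x| <= 1 & `|f| - e < `|f x|.
Proof.
move=> e0; have [_ [x x1 <-] xe] := sup_adherent e0 (opnorm_has_sup f).
by exists x.
Qed.

Lemma dual_norm_approx (E : normedModType R) (f : dual E) e : 0 < e ->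
  exists2 x, `|x| <= 1 & `|f| - e < f x.
Proof.
move=> /(blin_norm_approx f)[x x1 xe].
have [fx0|fx0] := leP 0 (f x).
  by exists x => //; move: xe; rewrite ger0_norm.
by exists (- x); rewrite ?normrN// linearN; move: xe; rewrite ltr0_norm.
Qed.

(** Since [0^-1 = 0], the zero vector goes to itself and [unitizeE] needs no side condition. *)
Definition unitize (E : normedModType R) (x : E) := `|x|^-1 *: x.

Lemma unitize_le1 (E : normedModType R) (x : E) : `|unitize x| <= 1.
Proof.
rewrite normrZ normfV normr_id; have [->|x0] := eqVneq x 0.
  by rewrite normr0 mulr0.
by rewrite mulVf ?normr_eq0.
Qed.

Lemma unitizeE (E : normedModType R) (x : E) : x = `|x| *: unitize x.
Proof.
rewrite scalerA; have [->|x0] := eqVneq x 0; first by rewrite scaler0.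
by rewrite mulfV ?scale1r ?normr_eq0.
Qed.

End BoundedMaps.

(** * Limits of bounded sequences along an ultrafilter, and weak* limits in the bidual *)

Section UltrafilterLimit.
Variables (R : realType) (U : set_system nat).
Hypothesis UU : UltraFilter U.

Let PU : ProperFilter U := ultra_proper.

Definition ulim (a : nat -> R) : R := lim (a @ U).

Lemma fmap_ultra (T : Type) (a : nat -> T) : UltraFilter (a @ U).
Proof.
split=> [|G PG aUG]; first exact: fmap_proper_filter.
apply/seteqP; split=> // A GA.
have [//|UC] := in_ultra_setVsetC (a @^-1` A) UU.
have GC : G (~` A) by exact: aUG.
by have [x []] := filter_ex (filterI GA GC).
Qed.

(** The image of [U] is an ultrafilter containing a compact segment, hence converges; without
    convergence [lim] would be a meaningless default value. *)
Lemma ulim_cvg (a : nat -> R) M : (forall n, `|a n| <= M) ->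
  a @ U --> ulim a.
Proof.
move=> aM; have aU := fmap_ultra a.
have := @segment_compact R (- M) M; rewrite compact_ultra => /(_ _ aU).
have aS : (a @ U) [set` `[- M, M]].
  by apply: (@filterE _ U) => n; rewrite /= in_itv /= -ler_norml.
move=> /(_ aS) [x [_ /= ax]].
have : cvg (a @ U) by apply/cvg_ex; exists x.
exact.
Qed.

Lemma ulim_unique (a : nat -> R) l : a @ U --> l -> ulim a = l.
Proof. exact: cvg_lim. Qed.

Lemma ulim_cst c : ulim (fun=> c) = c.
Proof. by apply: ulim_unique; exact: cvg_cst. Qed.

Lemma ulim_linear (a b : nat -> R) M N k : (forall n, `|a n| <= M) ->
  (forall n, `|b n| <= N) ->
  ulim (fun n => k * a n + b n) = k * ulim a + ulim b.
Proof.
move=> /ulim_cvg ca /ulim_cvg cb; apply: ulim_unique.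
apply: cvgD => //; apply: cvgM => //; exact: cvg_cst.
Qed.

Lemma ulim_le (a : nat -> R) M c : (forall n, `|a n| <= M) ->
  (forall n, a n <= c) -> ulim a <= c.
Proof.
by move=> /ulim_cvg ca ac; apply: (cvgr_to_le ca); exact: filterE.
Qed.

Lemma ulim_ge_near (a : nat -> R) M c : (forall n, `|a n| <= M) ->
  (\forall n \near U, c <= a n) -> c <= ulim a.
Proof. by move=> /ulim_cvg ca ac; exact: (cvgr_to_ge ca). Qed.

(** Weak* compactness in the form needed: pointwise limits on the dual exist by boundedness, and
    they inherit linearity and the bound. *)
Lemma weak_ulim (E : normedModType R) (a : nat -> E) M : 0 <= M ->
  (forall n, `|a n| <= M) ->
  exists2 u : bidual E, (forall h : dual E, u h = ulim (fun n => h (a n)))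
    & `|u| <= M.
Proof.
move=> M0 aM.
have haM (h : dual E) n : `|h (a n)| <= `|h| * M.
  by rewrite (le_trans (blin_norm_le h _))// ler_wpM2l.
apply: (@blin_of_bound R (dual E) R^o (fun h => ulim (fun n => h (a n)))) => //.
  move=> k h g; rewrite -(ulim_linear _ (haM h) (haM g)).
  by congr ulim; apply/funext => n; rewrite blinD blinZ.
move=> h; rewrite ler_norml; apply/andP; split.
  apply: ulim_ge_near (haM h) _; apply: filterE => n.
  by have := haM h n; rewrite ler_norml mulrC => /andP[].
apply: ulim_le (haM h) _ => n.
by have := haM h n; rewrite ler_norml mulrC => /andP[].
Qed.

End UltrafilterLimit.

(** * Slices of Daugavet spaces and L-orthogonal elements *)

Section DaugavetSlices.
Variables (R : realType) (E : normedModType R).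

Lemma unit_functional_le (u : bidual E) (h : dual E) : `|u| <= 1 -> u h <= `|h|.
Proof.
by move=> u1; rewrite (le_trans (functional_le u h))// ler_piMl.
Qed.

(** The property is applied to [v |-> f v *: x], of norm [|x|]; [v] almost norms its sum with the
    identity, and [xs] norms the image of [v]. Changing the sign of both makes [xs x]
    nonnegative. *)
Lemma daugavet_functional (f : dual E) (x : E) :
  daugavet E -> `|f| = 1 -> x != 0 -> forall e, 0 < e ->
  exists v xs, [/\ `|v| <= 1, `|xs : dual E| <= 1, 0 <= xs x &
    1 + `|x| - e < xs v + xs x * f v].
Proof.
move=> dE f1 x0 e e0.
have nx : 0 < `|x| by rewrite normr_gt0.
have [T TE Tx] : exists2 T : blin E E, (forall v, T v = f v *: x) & `|T| <= `|x|.
  apply: blin_of_bound => // [k v w|v].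
    by rewrite linearP scalerDl scalerA.
  rewrite normrZ mulrC ler_wpM2l//.
  by have := blin_norm_le f v; rewrite f1 mul1r.
have nT : `|T| = `|x|.
  apply/le_anti; rewrite Tx /=; apply/ler_addgt0Pr => d d0.
  have dx0 : 0 < d / `|x| by rewrite divr_gt0.
  have [v v1 fv] := dual_norm_approx f dx0.
  have := blin_norm_le T v; rewrite TE normrZ.
  move: fv; rewrite f1 ltrBlDr -ltrBlDl => fv.
  have : `|x| - d <= `|f v| * `|x|.
    have -> : `|x| - d = (1 - d / `|x|) * `|x| by field; rewrite gt_eqF.
    by rewrite ler_wpM2r// (le_trans _ (ler_norm _))//; lra.
  have : `|T| * `|v| <= `|T| by rewrite ler_piMr.
  lra.
have rT : rank_one T.
  exists x => //; apply/seteqP; split=> [_ [v _ <-]|_ [a _ <-]] /=.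
    by exists (f v).
  (* Error [1] against [|f| = 1] leaves [f v > 0], enough to reach every multiple of [x]. *)
  have [v _] := dual_norm_approx f (ltr01 : 0 < 1 :> R).
  rewrite f1 subrr => fv; exists ((a / f v) *: v) => //.
  by rewrite TE functionalZ -mulrA mulVf ?mulr1// gt_eqF.
have [v v1] := blin_norm_approx (T + blin_id E) e0.
rewrite dE// nT blinD TE /=.
have [xs [xs1 <-]] := norming_functional (f v *: x + v).
rewrite functionalD functionalZ => h.
have [a0|a0] := leP 0 (xs x).
  by exists v, xs; split=> //; rewrite [xs v + _]addrC [xs x * _]mulrC.
exists (- v), (- xs); split; rewrite ?normrN//; last first.
  rewrite -[- xs]scaleN1r !dualZ -[- v]scaleN1r !functionalZ !mulN1r opprK mulrNN.
  by rewrite [xs v + _]addrC [xs x * _]mulrC.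
by rewrite -scaleN1r dualZ mulN1r oppr_ge0 ltW.
Qed.

(** The slice is cut by the normalized [xs + xs x *: f]. There both terms of [u xs + xs x * u f] are
    almost maximal: the second bounds [u f] below, and [xs] tested on [x + u] gives the norm
    estimate. Taking [u] in the bidual lets the estimate apply to weak* limits. *)
Lemma daugavet_slice (f : dual E) (x : E) :
  daugavet E -> `|f| = 1 -> x != 0 -> forall e, 0 < e -> e < `|x| ->
  exists g : dual E, exists2 c : R, `|g| = 1 /\ c < 1 &
    forall u : bidual E, `|u| <= 1 -> c <= u g ->
      1 - e / `|x| <= u f /\ 1 + `|x| - e <= `|bidual_embedding x + u|.
Proof.
move=> dE f1 x0 e e0 ex.
have [v [xs [v1 xs1 a0 big]]] := daugavet_functional dE f1 x0 e0.
have nx : 0 < `|x| by rewrite normr_gt0.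
pose g := xs + xs x *: f.
have gv : 1 + `|x| - e < `|g|.
  apply: lt_le_trans big _; have := functional_le g v.
  rewrite blinD dualZ => h; rewrite (le_trans h)// ler_piMr//.
have g0 : 0 < `|g| by lra.
exists (`|g|^-1 *: g), ((1 + `|x| - e) / `|g|).
  split; last by rewrite ltr_pdivrMr// mul1r.
  by rewrite normrZ normfV normr_id mulVf// gt_eqF.
move=> u u1; rewrite functionalZ [_^-1 * _]mulrC ler_pM2r ?invr_gt0//.
rewrite functionalD functionalZ => ug.
have uf1 : u f <= 1 by rewrite -f1; exact: unit_functional_le.
have us1 : u xs <= 1 by exact: le_trans (unit_functional_le _ u1) xs1.
have ax : xs x <= `|x|.
  by rewrite (le_trans (functional_le xs x))// ler_piMl.
have ug' : `|x| - e <= xs x * u f by lra.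
(* Here [e < |x|] is used: it makes the product [xs x * u f] positive. *)
have uf0 : 0 <= u f.
  rewrite leNgt; apply/negP => uf0.
  have : xs x * u f <= 0 by rewrite mulr_ge0_le0// ltW.
  lra.
split.
  rewrite -(ler_pM2r nx) mulrBl mulfVK ?gt_eqF// mul1r.
  by rewrite (le_trans ug')// mulrC ler_wpM2l.
have : xs x * u f <= xs x by rewrite ler_piMr.
have : (bidual_embedding x + u) xs <= `|bidual_embedding x + u|.
  by rewrite (le_trans (functional_le _ _))// ler_piMr.
rewrite blinD /=; lra.
Qed.

End DaugavetSlices.

(** * Nested slices and an L-orthogonal weak* limit *)

Section SeparableDaugavet.
Variables (R : realType) (E : normedModType R).

Lemma bidual_embedding_le (x : E) : `|bidual_embedding x| <= `|x|.
Proof.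
apply: opnorm_le => h h1 /=; rewrite (le_trans (blin_norm_le h x))//.
by rewrite ler_piMl.
Qed.

(** Slices are kept as data so that choice can iterate on them; a level below [1] makes each one
    meet the unit ball of [E]. *)
Definition slice := {s : dual E * R | `|s.1| = 1 /\ s.2 < 1}.

Definition in_slice (u : bidual E) (s : slice) := (sval s).2 <= u (sval s).1.

Lemma slice_step (s : slice) (x : E) (e : R) : daugavet E -> 0 < e ->
  exists s' : slice, forall u : bidual E, `|u| <= 1 -> in_slice u s' ->
    in_slice u s /\ (x != 0 -> 1 + `|x| - e <= `|bidual_embedding x + u|).
Proof.
case: s => -[f c] [/= f1 c1] dE e0.
have [x0|x0] := eqVneq x 0.
  by exists (exist _ (f, c) (conj f1 c1)) => u.
have nx : 0 < `|x| by rewrite normr_gt0.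
have c0 : 0 < 1 - c by rewrite subr_gt0.
(* The three terms give, in turn, the required norm gap, [c <= 1 - d / |x|] so that the new slice
   lies in the old one, and [d < |x|]. *)
pose d := Num.min e (Num.min ((1 - c) * `|x|) (`|x| / 2)).
have d0 : 0 < d by rewrite !lt_min e0 mulr_gt0//= divr_gt0.
have [de [dc dx]] : d <= e /\ d <= (1 - c) * `|x| /\ d <= `|x| / 2.
  by rewrite !ge_min !lexx !orbT.
have dx1 : d < `|x| by lra.
have [g [k [g1 k1] gk]] := daugavet_slice dE f1 x0 d0 dx1.
exists (exist (fun s : dual E * R => `|s.1| = 1 /\ s.2 < 1) (g, k) (conj g1 k1)).
move=> u u1 /(gk u u1)[h1 h2]; split=> [|_]; last by lra.
rewrite /in_slice /=; rewrite (le_trans _ h1)//.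
by rewrite lerBrDl -lerBrDr ler_pdivrMr.
Qed.

Lemma slice_point (s : slice) :
  exists2 y : E, `|y| <= 1 & in_slice (bidual_embedding y) s.
Proof.
case: s => -[f c] [/= f1 c1].
have c0 : 0 < 1 - c by rewrite subr_gt0.
have [y y1 fy] := dual_norm_approx f c0; exists y => //.
by rewrite /in_slice /=; move: fy; rewrite f1; lra.
Qed.

Lemma separable_enum : separable E ->
  exists d : nat -> E, forall x e, 0 < e -> exists n, `|x - d n| < e.
Proof.
move=> [D /countable_injP[i iinj] dD].
have /choice[d dP] : forall n, exists x, forall y, D y -> i y = n -> x = y.
  move=> n; have [[x [Dx xn]]|nx] := pselect (exists x, D x /\ i x = n).
    by exists x => y Dy yn; apply: iinj; rewrite ?inE// xn.
  by exists 0 => y Dy yn; exfalso; apply: nx; exists y.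
exists d => x e e0.
have [|y []] := dD (ball x e) _ (ball_open x e).
  by exists x; exact: ballxx.
by rewrite -ball_normE /= => xy Dy; exists (i y); rewrite (dP _ _ Dy erefl).
Qed.

(** Slices are shrunk so that every pair of a dense term [d k] and an error [e m] is treated at some
    stage. The weak* limit [u] lies in all of them, so it satisfies the estimate exactly at each
    nonzero [d k], then everywhere by density. *)
Lemma separable_daugavet_Lorthogonal (U : set_system nat) (f : dual E) (a : R) :
  UltraFilter U -> \oo `<=` U ->
  separable E -> daugavet E -> `|f| = 1 -> 0 < a ->
  exists (y : nat -> E) (u : bidual E),
    [/\ forall n, `|y n| <= 1, forall n, 1 - a <= f (y n), `|u| <= 1,
        forall h : dual E, u h = ulim U (fun n => h (y n)) &
        forall x, x != 0 -> 1 + `|x| <= `|bidual_embedding x + u|].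
Proof.
move=> UU ooU /separable_enum[d dP] dE f1 a0.
have a1 : 1 - a < 1 by lra.
pose e m : R := m.+1%:R^-1.
have e0 m : 0 < e m by rewrite invr_gt0.
have /choice[st stP] : forall p : slice * (nat * nat), exists s' : slice,
    forall u : bidual E, `|u| <= 1 -> in_slice u s' -> in_slice u p.1 /\
      (d p.2.1 != 0 -> 1 + `|d p.2.1| - e p.2.2 <=
                       `|bidual_embedding (d p.2.1) + u|).
  by move=> p; exact: slice_step.
pose s0 : slice :=
  exist (fun s : dual E * R => `|s.1| = 1 /\ s.2 < 1) (f, 1 - a) (conj f1 a1).
(* Stage [n] treats the pair coded by [n]; numbers that code no pair merely treat [(0, 0)] again. *)
pose q n : nat * nat := odflt (0, 0)%N (unpickle n).
pose s := fix s n := if n is m.+1 then st (s m, q m) else s0.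
have sS n (u : bidual E) : `|u| <= 1 -> in_slice u (s n.+1) -> in_slice u (s n).
  by move=> u1 /(stP (s n, q n) u u1)[].
have sD n m (u : bidual E) : `|u| <= 1 -> in_slice u (s (m + n)%N) ->
    in_slice u (s n).
  by move=> u1; elim: m => // m IH /(sS _ _ u1).
have /choice[y yP] : forall n, exists y : E,
    `|y| <= 1 /\ in_slice (bidual_embedding y) (s n).
  by move=> n; have [y] := slice_point (s n); exists y.
have y1 n : `|y n| <= 1 by have [] := yP n.
have ey1 n : `|bidual_embedding (y n)| <= 1.
  exact: le_trans (bidual_embedding_le _) (y1 n).
have [u uE u1] := weak_ulim UU ler01 y1.
exists y, u; split=> // [n|].
  by have [_] := yP n; rewrite -[n]addn0 => /(sD 0%N n _ (ey1 _)).
have us n : in_slice u (s n).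
  rewrite /in_slice uE.
  have bd m : `|(sval (s n)).1 (y m)| <= 1.
    by rewrite (le_trans (blin_norm_le _ _))// (svalP (s n)).1 mul1r.
  (* By nestedness all [y m] with [m >= n] lie in [s n], and [U] contains this tail. *)
  apply: (ulim_ge_near UU bd); apply: ooU; exists n => // m /= nm.
  have [_] := yP m; rewrite -(subnK nm); exact: sD (ey1 _).
have ud k : d k != 0 -> 1 + `|d k| <= `|bidual_embedding (d k) + u|.
  move=> dk0; apply/ler_addgt0Pr => r r0.
  have [m mr] : exists m, e m < r.
    exists (Num.truncn r^-1); rewrite /e invf_plt ?posrE//.
    by rewrite truncnS_gt.
  have := us (pickle (k, m)).+1 => /(stP (s _, q _) u u1) [_ /=].
  by rewrite /q pickleK /= => /(_ dk0); lra.
move=> x x0; apply/ler_addgt0Pr => r r0.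
have nx : 0 < `|x| by rewrite normr_gt0.
(* The bound [|x|] forces [d n] to be nonzero; [r / 2] pays for replacing [x] by [d n] on both
   sides. *)
have m0 : 0 < Num.min (r / 2) `|x| by rewrite lt_min nx divr_gt0.
have [n] := dP x _ m0; rewrite lt_min => /andP[xr xx].
have dn0 : d n != 0 by apply/eqP => dn0; move: xx; rewrite dn0 subr0 ltxx.
have h1 := ud n dn0.
have h2 : `|x| <= `|d n| + `|x - d n|.
  by rewrite (le_trans _ (ler_normD _ _))// addrC subrK.
have h3 : `|bidual_embedding (d n) + u| <=
    `|bidual_embedding x + u| + `|x - d n|.
  have -> : bidual_embedding (d n) + u =
      (bidual_embedding x + u) - bidual_embedding (x - d n).
    apply: blin_ext => h; rewrite dualB !dualD /= functionalB opprB.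
    by rewrite [RHS]addrC addrA subrK.
  by rewrite (le_trans (ler_normB _ _))// lerD2l bidual_embedding_le.
move: h1 h2 h3 xr; move: `|bidual_embedding (d n) + u|.
move: `|bidual_embedding x + u| `|d n| `|x| `|x - d n|.
by clear => *; lra.
Qed.

End SeparableDaugavet.

(** * Forms of finite type on the bidual *)

Section FiniteRank.
Variable R : realType.

(** Induction: if [Q] fixes [W] but not [w0], a normalized functional norming [w0 - Q w0], composed
    with [id - Q], vanishes on [W] and is [1] at [w0]. It is the coefficient of the new vector
    [w0 - Q w0]. *)
Lemma finite_dim_projection (E : normedModType R) (W : seq E) :
  exists s : seq (dual E * E),
    forall w, w \in W -> \sum_(p <- s) p.1 w *: p.2 = w.
Proof.
elim: W => [|w0 W [s sW]]; first by exists [::].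
pose Q x := \sum_(p <- s) p.1 x *: p.2.
have [w0E|w0NE] := eqVneq (w0 - Q w0) 0.
  exists s => w; rewrite in_cons => /predU1P[->|]; last exact: sW.
  by apply/esym/eqP; rewrite -subr_eq0 w0E.
have [F [_ Fw]] := norming_functional (w0 - Q w0).
have n0 : `|w0 - Q w0| != 0 by rewrite normr_eq0.
pose G : dual E := `|w0 - Q w0|^-1 *: (F - \sum_(p <- s) F p.2 *: p.1).
have GE x : G x = `|w0 - Q w0|^-1 * F (x - Q x).
  rewrite /G dualZ dualB functionalB dual_sum functional_sum.
  by under [in RHS]eq_bigr do rewrite functionalZ mulrC.
exists ((G, w0 - Q w0) :: s) => w; rewrite in_cons big_cons [_.1]/= GE.
move=> /predU1P[->|wW]; first by rewrite Fw mulVf// scale1r subrK.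
by rewrite /Q (sW w wW) subrr linear0 mulr0 scale0r add0r.
Qed.

(** [finite_rank] gives coefficients pointwise only. Following [T] by an operator that fixes the
    [v i] makes them bounded functionals of [x]. *)
Lemma finite_rank_sum (E F : normedModType R) (T : blin E F) : finite_rank T ->
  exists s : seq (dual E * F), forall x, T x = \sum_(p <- s) p.1 x *: p.2.
Proof.
move=> [n [v Tv]].
have [s sv] := finite_dim_projection [seq v i | i <- enum 'I_n].
have /choice[G GE] : forall g : dual F, exists G : dual E, forall x, G x = g (T x).
  move=> g; have [||x|G GE _] := @blin_of_bound R E R^o (fun x => g (T x))
      (`|g| * `|T|); last by exists G.
  - by move=> a x y; rewrite linearP functionalD functionalZ.
  - by rewrite mulr_ge0.
  - by rewrite (le_trans (blin_norm_le _ _))// -mulrA ler_wpM2l// blin_norm_le.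
exists [seq (G p.1, p.2) | p <- s] => x; rewrite big_map.
under eq_bigr do rewrite /= GE.
have [c ->] := Tv x.
under eq_bigr => p _ do rewrite functional_sum scaler_suml.
rewrite exchange_big /=; apply: eq_bigr => i _.
under eq_bigr => p _ do rewrite functionalZ -scalerA.
by rewrite -scaler_sumr sv// map_f// mem_enum.
Qed.

(** Each [f] maps the ball into [[- |f|, |f|]], which is cut into finitely many cells of length [d];
    the class of a point records its cell for every [f]. *)
Lemma functional_partition (E : normedModType R) (s : seq (dual E)) (d : R) :
  0 < d -> exists (K : finType) (k : E -> K), forall x y,
    `|x| <= 1 -> `|y| <= 1 -> k x = k y ->
    forall f, f \in s -> `|f x - f y| <= d.
Proof.
move=> d0; elim: s => [|f s [K [k kP]]]; first by exists unit, (fun=> tt).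
pose N := Num.truncn ((`|f| + `|f|) / d).
pose b x : 'I_N.+1 := inord (Num.truncn ((f x + `|f|) / d)).
exists (K * 'I_N.+1)%type, (fun x => (k x, b x)) => x y x1 y1 [kxy bxy] g.
rewrite in_cons => /predU1P[->{g}|]; last exact: kP.
have rng z : `|z| <= 1 -> 0 <= (f z + `|f|) / d /\
    (Num.truncn ((f z + `|f|) / d) < N.+1)%N.
  move=> z1; have fz : `|f z| <= `|f|.
    by rewrite (le_trans (blin_norm_le _ _))// ler_piMr.
  move: fz; rewrite ler_norml => /andP[fz1 fz2]; split.
    by rewrite divr_ge0 ?(ltW d0)//; lra.
  by rewrite ltnS le_truncn// ler_wpM2r ?invr_ge0 ?(ltW d0)//; lra.
have [x0 xN] := rng x x1; have [y0 yN] := rng y y1.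
have := congr1 val bxy; rewrite /= !inordK// => xy.
have := truncn_itv x0; have := truncn_itv y0.
rewrite -xy => /andP[h1 h2] /andP[h3 h4].
have -> : f x - f y = ((f x + `|f|) / d - (f y + `|f|) / d) * d.
  by field; rewrite gt_eqF.
rewrite normrM (gtr0_norm d0) ler_piMl ?(ltW d0)// ler_norml.
move: h2 h4; rewrite -natr1; lra.
Qed.

(** One representative in the ball is chosen per class; a class that misses the ball gets [0]. *)
Lemma functional_net (E : normedModType R) (s : seq (dual E)) (d : R) :
  0 < d -> exists (K : finType) (k : E -> K) (g : K -> E),
    (forall i, `|g i| <= 1) /\ forall x, `|x| <= 1 ->
      forall f, f \in s -> `|f x - f (g (k x))| <= d.
Proof.
move=> /(functional_partition s)[K [k kP]].
have /choice[g gP] : forall i : K, exists y : E, `|y| <= 1 /\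
    ((exists2 x, `|x| <= 1 & k x = i) -> k y = i).
  move=> i; have [[x x1 xi]|nx] := pselect (exists2 x, `|x| <= 1 & k x = i).
    by exists x.
  by exists 0; split=> //; rewrite normr0.
exists K, k, g; split=> [i|x x1 f fs]; first by have [] := gP i.
have [g1 gx] := gP (k x).
by apply: (kP _ _ x1 g1 _ _ fs); rewrite gx//; exists x.
Qed.

End FiniteRank.

Section UltrafilterLimitSum.
Variables (R : realType) (U : set_system nat).
Hypothesis UU : UltraFilter U.

Lemma ulim_sum I (r : seq I) (k : I -> R) (a : I -> nat -> R) (M : I -> R) :
  (forall i n, `|a i n| <= M i) ->
  ulim U (fun n => \sum_(i <- r) k i * a i n) =
  \sum_(i <- r) k i * ulim U (a i).
Proof.
move=> aM; elim: r => [|i r IH].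
  rewrite big_nil; apply: ulim_unique.
  by under eq_fun do rewrite big_nil; exact: cvg_cst.
rewrite big_cons -IH -(ulim_linear UU _ (aM i) (N := \sum_(j <- r) `|k j| * M j)).
  by congr ulim; apply/funext => n; rewrite big_cons.
move=> n; rewrite (le_trans (ler_norm_sum _ _ _))// ler_sum// => j _.
by rewrite normrM ler_wpM2l.
Qed.

(** Weak* lower semicontinuity: functionals [h k] almost norming the [u k] are tested on the
    sequences before the limit. *)
Lemma weak_ulim_norm_sum (E : normedModType R) (K : finType)
    (a : K -> nat -> E) (u : K -> bidual E) (c : R) :
  (forall n, \sum_k `|a k n| <= c) ->
  (forall k (h : dual E), u k h = ulim U (fun n => h (a k n))) ->
  \sum_k `|u k| <= c.
Proof.
move=> ac uE; apply/ler_addgt0Pr => e e0.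
(* The successor keeps the denominator nonzero when [K] is empty. *)
pose d := e / #|K|.+1%:R.
have d0 : 0 < d by rewrite divr_gt0.
have /choice[h hP] : forall k, exists h : dual E, `|h| <= 1 /\ `|u k| - d <= u k h.
  by move=> k; have [h h1 /ltW uh] := dual_norm_approx (u k) d0; exists h.
have ak k n : `|a k n| <= c.
  by rewrite (le_trans _ (ac n))// (bigD1 k)//= lerDl sumr_ge0.
have hak k n : `|h k (a k n)| <= `|a k n|.
  by rewrite (le_trans (blin_norm_le _ _))// ler_piMl// (hP k).1.
have hc k n : `|h k (a k n)| <= c by exact: le_trans (hak k n) (ak k n).
have bd n : `|\sum_k 1 * h k (a k n)| <= c.
  rewrite (le_trans (ler_norm_sum _ _ _))// (le_trans _ (ac n))// ler_sum// => k _.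
  by rewrite mul1r.
have : \sum_k u k (h k) <= c.
  have -> : \sum_k u k (h k) = ulim U (fun n => \sum_k 1 * h k (a k n)).
    rewrite (@ulim_sum _ _ (fun=> 1) (fun k n => h k (a k n)) (fun=> c))//.
    by apply: eq_bigr => k _; rewrite mul1r uE.
  by apply: (ulim_le UU bd) => n; rewrite (le_trans (ler_norm _)).
have : \sum_k (`|u k| - d) <= \sum_k u k (h k).
  by apply: ler_sum => k _; exact: (hP k).2.
rewrite big_split /= sumr_const.
have : - d *+ #|[pred k : K | true]| >= - e.
  rewrite mulNrn lerN2 -mulr_natr /d mulrAC ler_pdivrMr// ler_wpM2l ?ltW//.
  by rewrite ltr_nat ltnS max_card.
lra.
Qed.

End UltrafilterLimitSum.

(** * Passing to weak* limits in representations of tensors *)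

Section FiniteTypeForms.
Variables (R : realType) (X Y : normedModType R).

Lemma projective_norm_lt (s : seq (X * Y)) c : projective_norm s < c ->
  exists2 s', tensor_eq s s' & \sum_(p <- s') `|p.1| * `|p.2| < c.
Proof.
move=> sc; have [|_ [s' ss' <-] lt] := inf_lt _ sc; last by exists s'.
by exists (\sum_(p <- s) `|p.1| * `|p.2|), s.
Qed.

Lemma bilinear_map_functionals (h : dual X) (g : dual Y) :
  @bilinear_map R X Y R^o (fun x y => h x * g y).
Proof.
split=> [y a x x'|x a y y'].
  by rewrite functionalD functionalZ mulrDl -mulrA.
by rewrite functionalD functionalZ mulrDr mulrCA.
Qed.

Variable U : set_system nat.
Hypothesis UU : UltraFilter U.

(* [s] holds the second factors of a form of finite type. In a representation of
   [(a n, y0) :: L], second factors are normalized and replaced by points [g k] of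
   a finite net for [s]; [u k] and [v] are the weak* limits of the sums of first
   factors sharing the net point [g k], and of the errors. *)
Lemma tensor_eq_ulim (s : seq (dual Y)) (d c : R) (L : seq (X * Y)) (y0 : Y)
    (a : nat -> X) (z : bidual X) :
  0 < d -> (forall n, `|a n| <= 1) ->
  (forall h : dual X, z h = ulim U (fun n => h (a n))) ->
  (forall n, projective_norm ((a n, y0) :: L) < c) ->
  exists (K : finType) (u : K -> bidual X) (g : K -> Y),
    [/\ \sum_k `|u k| <= c, forall k, `|g k| <= 1 &
      forall f, f \in s -> exists2 v : bidual X, `|v| <= d * c &
        f y0 *: z + \sum_(q <- L) f q.2 *: bidual_embedding q.1 =
        \sum_k f (g k) *: u k + v].
Proof.
move=> d0 a1 zE pc.
have /choice[r rP] : forall n, exists r, tensor_eq ((a n, y0) :: L) r /\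
    \sum_(p <- r) `|p.1| * `|p.2| < c.
  by move=> n; have [r] := projective_norm_lt (pc n); exists r.
have rc n : \sum_(p <- r n) `|p.1| * `|p.2| <= c by exact/ltW/(rP n).2.
have c0 : 0 <= c by rewrite (le_trans _ (rc 0%N))// sumr_ge0.
have [K [kappa [g [g1 gP]]]] := functional_net s d0.
pose k y := kappa (unitize y).
(* The norm of each second factor moves to the first one, so the norms of the [w j n] sum to at most
   the cost of [r n]. *)
pose w j n := \sum_(q <- r n | k q.2 == j) `|q.2| *: q.1.
have wc n : \sum_j `|w j n| <= c.
  rewrite (le_trans _ (rc n))// [leRHS](partition_big (fun q => k q.2) xpredT)//=.
  apply: ler_sum => j _; rewrite (le_trans (ler_norm_sum _ _ _))//.
  by apply: ler_sum => q _; rewrite normrZ normr_id mulrC.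
have wjc j n : `|w j n| <= c.
  by rewrite (le_trans _ (wc n))// (bigD1 j)//= lerDl sumr_ge0.
have /choice[u uE] : forall j, exists u : bidual X,
    forall h : dual X, u h = ulim U (fun n => h (w j n)).
  by move=> j; have [u] := weak_ulim UU c0 (wjc j); exists u.
exists K, u, g; split=> //; first exact: weak_ulim_norm_sum wc uE.
move=> f fs.
pose e n := \sum_(q <- r n)
  (`|q.2| * (f (unitize q.2) - f (g (k q.2)))) *: q.1.
have ec n : `|e n| <= d * c.
  rewrite (le_trans (ler_norm_sum _ _ _))//.
  rewrite (le_trans _ (ler_wpM2l (ltW d0) (rc n)))// mulr_sumr ler_sum// => q _.
  rewrite normrZ normrM normr_id mulrAC [leRHS]mulrC [`|q.1| * _]mulrC.
  by rewrite ler_wpM2l ?mulr_ge0// gP// unitize_le1.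
have dc0 : 0 <= d * c by rewrite mulr_ge0// ltW.
have [v vE vdc] := weak_ulim UU dc0 ec.
exists v => //; apply: blin_ext => h.
rewrite !dualD !dual_sum vE dualZ zE.
have hb (b : nat -> X) M : (forall n, `|b n| <= M) ->
    forall n, `|h (b n)| <= `|h| * M.
  by move=> bM n; rewrite (le_trans (blin_norm_le _ _))// ler_wpM2l.
pose C := \sum_(q <- L) f q.2 * h q.1.
(* Both sides are turned into limits along [U]; it then suffices to compare them at each [n]. *)
have -> : \sum_(q <- L) (f q.2 *: bidual_embedding q.1) h = ulim U (fun=> C).
  by rewrite ulim_cst.
rewrite -(ulim_linear UU _ (hb _ _ a1) (N := `|C|))//.
under eq_bigr do rewrite dualZ uE.
have hw j n : `|h (w j n)| <= `|h| * c by exact: hb.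
rewrite -(ulim_sum UU _ _ hw) addrC -[ulim U (fun n => h (e n))]mul1r.
rewrite -(ulim_linear UU _ (hb _ _ ec)
  (N := \sum_j `|f (g j)| * (`|h| * c))); last first.
  move=> n; rewrite (le_trans (ler_norm_sum _ _ _))// ler_sum// => j _.
  by rewrite normrM ler_wpM2l.
congr ulim; apply/funext => n.
(* Equality of tensors is tested on the bilinear form [(x, y) |-> h x * f y]. *)
have -> : f y0 * h (a n) + C = \sum_(q <- r n) h q.1 * f q.2.
  have := (rP n).1 _ (bilinear_map_functionals h f).
  rewrite big_cons /= => <-; rewrite [f y0 * _]mulrC; congr (_ + _).
  by apply: eq_bigr => q _; rewrite mulrC.
have -> : \sum_j f (g j) * h (w j n) =
    \sum_(q <- r n) f (g (k q.2)) * (`|q.2| * h q.1).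
  rewrite [RHS](partition_big (fun q => k q.2) xpredT)//=.
  apply: eq_bigr => j _; rewrite functional_sum mulr_sumr.
  by apply: eq_bigr => q /eqP ->; rewrite functionalZ.
rewrite mul1r functional_sum -big_split /=; apply: eq_bigr => q _.
have fq : f q.2 = `|q.2| * f (unitize q.2) by rewrite -functionalZ -unitizeE.
by rewrite functionalZ fq; ring.
Qed.

(** After the rewriting of [tensor_eq_ulim], contractivity bounds the terms at [(u k, g k)] by [c]
    in all, and the errors [v p] cost at most [S * (d * c)]. *)
Lemma finite_type_form_ulim (s : seq (dual (bidual X) * dual Y)) (c : R)
    (L : seq (X * Y)) (y0 : Y) (a : nat -> X) (z : bidual X) :
  (forall u y, `|\sum_(p <- s) p.1 u * p.2 y| <= `|u| * `|y|) ->
  (forall n, `|a n| <= 1) ->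
  (forall h : dual X, z h = ulim U (fun n => h (a n))) ->
  (forall n, projective_norm ((a n, y0) :: L) < c) ->
  \sum_(q <- (z, y0) :: [seq (bidual_embedding q.1, q.2) | q <- L])
    \sum_(p <- s) p.1 q.1 * p.2 q.2 <= c.
Proof.
move=> s1 a1 zE pc; apply/ler_addgt0Pr => e e0.
pose S := \sum_(p <- s) `|p.1|.
have S0 : 0 <= S by rewrite sumr_ge0.
have c0 : 0 <= c.
  have [r _ rc] := projective_norm_lt (pc 0%N).
  by rewrite (le_trans _ (ltW rc))// sumr_ge0.
have Sc0 : 0 < S * c + 1 by rewrite ltr_wpDl// mulr_ge0.
(* Chosen for [S * (d * c) <= e]; adding [1] avoids a zero denominator. *)
pose d := e / (S * c + 1).
have d0 : 0 < d by rewrite divr_gt0.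
have [K [u [g [uc g1 uP]]]] :=
  tensor_eq_ulim [seq p.2 | p <- s] d0 a1 zE pc.
have /choice[v vP] : forall p : dual (bidual X) * dual Y, exists v : bidual X,
    p \in s -> `|v| <= d * c /\
      p.2 y0 *: z + \sum_(q <- L) p.2 q.2 *: bidual_embedding q.1 =
      \sum_k p.2 (g k) *: u k + v.
  move=> p; have [ps|] := boolP (p \in s); last by exists 0.
  by have [|v ? ?] := uP p.2; [exact: map_f|exists v].
rewrite exchange_big /=.
have -> : \sum_(p <- s) \sum_(q <- (z, y0) ::
      [seq (bidual_embedding q.1, q.2) | q <- L]) p.1 q.1 * p.2 q.2 =
    \sum_(p <- s) (\sum_k p.1 (u k) * p.2 (g k) + p.1 (v p)).
  apply: eq_big_seq => p /vP[_ E]; have := congr1 p.1 E.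
  rewrite !functionalD !functional_sum functionalZ => {}E.
  rewrite big_cons big_map /= mulrC.
  under eq_bigr do rewrite mulrC -functionalZ.
  by rewrite E; congr (_ + _); apply: eq_bigr => k _; rewrite functionalZ mulrC.
rewrite big_split /= exchange_big /= lerD//.
  rewrite (le_trans _ uc)// ler_sum// => k _.
  by rewrite (le_trans (ler_norm _))// (le_trans (s1 _ _))// ler_piMr.
rewrite (@le_trans _ _ (S * (d * c)))//.
  rewrite mulr_suml big_seq [leRHS]big_seq ler_sum// => p /vP[vd _].
  by rewrite (le_trans (functional_le _ _))// ler_wpM2l.
rewrite mulrCA /d mulrAC ler_pdivrMr// ler_wpM2l ?(ltW e0)//; lra.
Qed.

End FiniteTypeForms.

(** * Approximating contractive forms by forms of finite type *)

Section MetricApproximation.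
Variable R : realType.

Lemma approximating_operator (E : normedModType R) (W : seq E) (e : R) :
  metric_approximation_property E -> 0 < e ->
  exists S : blin E E,
    [/\ finite_rank S, `|S| <= 1 & forall w, w \in W -> `|w - S w| < e].
Proof.
move=> [A [le [S [[[a0] lexx lert dir] Sfin S1 Scvg]]]] e0.
have [a aW] : exists a, forall b, le a b -> forall w, w \in W -> `|w - S b w| < e.
  elim: W => [|w W [a aW]]; first by exists a0.
  have [a' _ a'w] := Scvg w _ (nbhsx_ballx w e e0).
  have [b ab a'b] := dir a a'; exists b => c bc x.
  rewrite in_cons => /predU1P[->|]; last exact: aW (lert _ _ _ ab bc) _.
  by have := a'w c (lert _ _ _ a'b bc); rewrite /= -ball_normE.
by exists (S a); split=> // w; exact: aW.
Qed.

Definition contractive_form (V W : normedModType R) (B : V -> W -> R) :=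
  @bilinear_map R V W R^o B /\ forall u y, `|B u y| <= `|u| * `|y|.

Lemma contractive_form_functional (V W : normedModType R) (B : V -> W -> R) u :
  contractive_form B -> exists f : dual W, forall y, f y = B u y.
Proof.
move=> [[_ Bl] B1].
have [f fE _] := blin_of_bound (F := R^o) (Bl u) (normr_ge0 u) (B1 u).
by exists f.
Qed.

(** The form [B (S u) y], for a finite-rank contraction [S] close to the identity on the first
    factors of [M], is contractive and of finite type. *)
Lemma form_approx_l (V W : normedModType R) (B : V -> W -> R) (e : R)
    (M : seq (V * W)) :
  contractive_form B -> metric_approximation_property V -> 0 < e ->
  exists s : seq (dual V * dual W),
    (forall u y, `|\sum_(p <- s) p.1 u * p.2 y| <= `|u| * `|y|) /\
    \sum_(q <- M) B q.1 q.2 <=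
      \sum_(q <- M) \sum_(p <- s) p.1 q.1 * p.2 q.2 + e.
Proof.
move=> Bc mapV e0; have [[Bl Br] B1] := Bc.
(* An error of [e / (N + 1)] on each first factor changes the sum over [M] by at most [e]. *)
pose N := \sum_(q <- M) `|q.2|.
have N0 : 0 <= N by rewrite sumr_ge0.
have N1 : 0 < N + 1 by rewrite ltr_wpDl.
have eN : 0 < e / (N + 1) by rewrite divr_gt0.
have [S [/finite_rank_sum[s SE] S1 SM]] :=
  approximating_operator [seq q.1 | q <- M] mapV eN.
have /choice[G GE] : forall u : V, exists f : dual W, forall y, f y = B u y.
  by move=> u; exact: contractive_form_functional.
have BD u v y : B (u + v) y = B u y + B v y.
  by have := Bl y 1 u v; rewrite !scale1r.
have BZ k u y : B (k *: u) y = k * B u y.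
  have B0 : B 0 y = 0 by have := BD 0 0 y; rewrite addr0; lra.
  by have := Bl y k u 0; rewrite addr0 B0 addr0.
have Bsum (r : seq (dual V * V)) u y :
    B (\sum_(p <- r) p.1 u *: p.2) y = \sum_(p <- r) p.1 u * B p.2 y.
  elim: r => [|p r IH]; last by rewrite !big_cons BD BZ IH.
  by rewrite !big_nil -(scale0r (0 : V)) BZ mul0r.
exists [seq (p.1, G p.2) | p <- s].
have sE u y : \sum_(p <- [seq (p.1, G p.2) | p <- s]) p.1 u * p.2 y = B (S u) y.
  by rewrite big_map SE Bsum; apply: eq_bigr => p _; rewrite /= GE.
split=> [u y|].
  rewrite sE (le_trans (B1 _ _))// ler_wpM2r//.
  by rewrite (le_trans (blin_norm_le _ _))// ler_piMl.
under [X in _ <= X + _]eq_bigr do rewrite sE.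
rewrite -lerBlDl -sumrB.
apply: (@le_trans _ _ (\sum_(q <- M) e / (N + 1) * `|q.2|)).
  rewrite big_seq [leRHS]big_seq; apply: ler_sum => q qM.
  have -> : B q.1 q.2 - B (S q.1) q.2 = B (q.1 - S q.1) q.2.
    by rewrite BD -[- S q.1]scaleN1r BZ mulN1r.
  rewrite (le_trans (ler_norm _))// (le_trans (B1 _ _))// ler_wpM2r//.
  by apply/ltW/SM; exact: map_f.
rewrite -mulr_sumr mulrAC ler_pdivrMr// ler_wpM2l ?(ltW e0)//.
by rewrite -/N lerDl.
Qed.

Lemma form_approx (V W : normedModType R) (B : V -> W -> R) (e : R)
    (M : seq (V * W)) :
  contractive_form B ->
  metric_approximation_property V \/ metric_approximation_property W -> 0 < e ->
  exists s : seq (dual V * dual W),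
    (forall u y, `|\sum_(p <- s) p.1 u * p.2 y| <= `|u| * `|y|) /\
    \sum_(q <- M) B q.1 q.2 <=
      \sum_(q <- M) \sum_(p <- s) p.1 q.1 * p.2 q.2 + e.
Proof.
move=> Bc [mapV|mapW] e0; first exact: form_approx_l.
have Bc' : contractive_form (fun y u => B u y).
  by case: Bc => -[Bl Br] B1; split=> // u y; rewrite mulrC.
have [s [s1 sM]] := form_approx_l [seq (q.2, q.1) | q <- M] Bc' mapW e0.
have sE u y : \sum_(p <- [seq (p.2, p.1) | p <- s]) p.1 u * p.2 y =
    \sum_(p <- s) p.1 y * p.2 u.
  by rewrite big_map; apply: eq_bigr => p _; rewrite mulrC.
exists [seq (p.2, p.1) | p <- s]; split=> [u y|].
  by rewrite sE mulrC.
move: sM; rewrite !big_map => sM; rewrite (le_trans sM)// lerD2r.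
by apply: ler_sum => q _; rewrite sE.
Qed.

End MetricApproximation.

(** * The l_1-projections of the bidual of an L-embedded space *)

Section LEmbedded.
Variables (R : realType) (X : normedModType R).

(** The norm identity makes the decomposition unique, so its components are linear. The last clause
    places L-orthogonal elements of the ball in the complement of [X]. *)
Lemma L_embedded_projection : L_embedded X ->
  exists (f : bidual X -> X) (g : bidual X -> bidual X),
    [/\ linear f, linear g, forall u, `|u| = `|f u| + `|g u|,
        forall x, f (bidual_embedding x) = x /\ g (bidual_embedding x) = 0 &
        forall u, `|u| <= 1 ->
          (forall x, x != 0 -> 1 + `|x| <= `|bidual_embedding x + u|) ->
          f u = 0 /\ g u = u].
Proof.
move=> [Z [[Z0 Zlin] dec _ Znorm]].
have embP (a : R) (x y : X) : bidual_embedding (a *: x + y) =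
    a *: bidual_embedding x + bidual_embedding y.
  by apply: blin_ext => h; rewrite dualD dualZ /= functionalD functionalZ.
have embB (x y : X) :
    bidual_embedding (x - y) = bidual_embedding x - bidual_embedding y.
  by apply: blin_ext => h; rewrite dualB /= functionalB.
have emb0 : bidual_embedding (0 : X) = 0 by rewrite -(subrr 0) embB subrr.
have ZB u v : u \in Z -> v \in Z -> u - v \in Z.
  by move=> uZ vZ; rewrite addrC -scaleN1r; exact: Zlin.
have /choice[d dP] : forall u : bidual X, exists d : X * bidual X,
    d.2 \in Z /\ u = bidual_embedding d.1 + d.2.
  by move=> u; have [x [z [zZ ->]]] := dec u; exists (x, z).
have uniq (x : X) z : z \in Z -> d (bidual_embedding x + z) = (x, z).
  move=> zZ; have [dZ] := dP (bidual_embedding x + z).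
  case: (d _) dZ => x' z' /= z'Z E.
  have := Znorm (x - x') (z - z') (ZB _ _ zZ z'Z).
  have -> : bidual_embedding (x - x') + (z - z') = 0.
    by rewrite embB addrACA -opprD -E subrr.
  rewrite normr0 => /esym/eqP; rewrite paddr_eq0//.
  by rewrite !normr_eq0 !subr_eq0 => /andP[/eqP -> /eqP ->].
have dE u : u = bidual_embedding (d u).1 + (d u).2 by have [] := dP u.
have dlin a u v : d (a *: u + v) =
    (a *: (d u).1 + (d v).1, a *: (d u).2 + (d v).2).
  have [uZ _] := dP u; have [vZ _] := dP v.
  rewrite -uniq; last exact: Zlin.
  by congr d; rewrite embP addrACA -scalerDr -!dE.
have dn u : `|u| = `|(d u).1| + `|(d u).2|.
  by rewrite {1}(dE u) Znorm//; have [] := dP u.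
exists (fun u => (d u).1), (fun u => (d u).2); split=> //.
- by move=> a u v; rewrite dlin.
- by move=> a u v; rewrite dlin.
- by move=> x; rewrite -[bidual_embedding x]addr0 uniq.
move=> u u1 orth.
(* Testing orthogonality at minus the [X]-component [x] of [u] gives [1 + |x| <= |u - x| = |u| - |x|
   <= 1 - |x|]. *)
have d0 : (d u).1 = 0.
  apply/eqP/negP => /negP ne0; have := orth (- (d u).1).
  rewrite oppr_eq0 normrN => /(_ ne0).
  have -> : bidual_embedding (- (d u).1) + u = (d u).2.
    by rewrite {2}(dE u) addrA -[- _]sub0r embB emb0 sub0r addNr add0r.
  move: u1; rewrite dn; have := normr_ge0 (d u).1.
  rewrite -normr_gt0 in ne0; move: ne0; move: `|(d u).1| `|(d u).2|.
  by clear => *; lra.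
by split=> //; rewrite [RHS]dE d0 emb0 add0r.
Qed.

End LEmbedded.

(** * Projective tensor products *)

Section ProjectiveTensor.
Variables (R : realType) (X Y P : normedModType R) (t : X -> Y -> P).
Hypothesis tbil : bilinear_map t.
Hypothesis tnorm :
  forall s : seq (X * Y), `|\sum_(p <- s) t p.1 p.2| = projective_norm s.
Hypothesis tdense :
  dense (range (fun s : seq (X * Y) => \sum_(p <- s) t p.1 p.2)).

Lemma tensorPl a x x' y : t (a *: x + x') y = a *: t x y + t x' y.
Proof. exact: tbil.1 y a x x'. Qed.

Lemma tensorPr a x y y' : t x (a *: y + y') = a *: t x y + t x y'.
Proof. exact: tbil.2 x a y y'. Qed.

Lemma tensor0l y : t 0 y = 0.
Proof.
have := tensorPl 1 0 0 y; rewrite !scale1r addr0 => /eqP.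
by rewrite -subr_eq0 opprD addrA subrr sub0r oppr_eq0 => /eqP.
Qed.

Lemma tensor0r x : t x 0 = 0.
Proof.
have := tensorPr 1 x 0 0; rewrite !scale1r addr0 => /eqP.
by rewrite -subr_eq0 opprD addrA subrr sub0r oppr_eq0 => /eqP.
Qed.

Lemma tensorZl a x y : t (a *: x) y = a *: t x y.
Proof. by have := tensorPl a x 0 y; rewrite tensor0l !addr0. Qed.

Lemma tensorZr a x y : t x (a *: y) = a *: t x y.
Proof. by have := tensorPr a x y 0; rewrite tensor0r !addr0. Qed.

Lemma tensor_norm_le x y : `|t x y| <= `|x| * `|y|.
Proof.
have := tnorm [:: (x, y)]; rewrite big_seq1 /= => ->.
apply: ge_inf.
  by exists 0 => _ [s _ <-]; exact: sumr_ge0.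
by exists [:: (x, y)] => //; rewrite big_seq1.
Qed.

Lemma tensor_dense (q : P) e : 0 < e ->
  exists s : seq (X * Y), `|q - \sum_(p <- s) t p.1 p.2| < e.
Proof.
move=> e0; have [|q' [qq' [s _ sq']]] := tdense _ (ball_open q e).
  by exists q; exact: ballxx.
by exists s; move: qq'; rewrite -sq' -ball_normE.
Qed.

Lemma functional_tensor_bilinear (F : dual P) :
  @bilinear_map R X Y R^o (fun x y => F (t x y)).
Proof.
by split=> [y a x x'|x a y y'];
  rewrite ?tensorPl ?tensorPr functionalD functionalZ.
Qed.

Lemma functional_tensor_le (F : dual P) x y : `|F (t x y)| <= `|F| * (`|x| * `|y|).
Proof.
by rewrite (le_trans (blin_norm_le _ _))// ler_wpM2l// tensor_norm_le.
Qed.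

(** Otherwise [F <= 1 - e] on products of unit balls, hence [F q <= (1 - e) * |q|], first on finite
    sums by taking cheap representations, then by density; this contradicts [|F| = 1]. *)
Lemma tensor_slice_point (F : dual P) e : `|F| = 1 -> 0 < e ->
  exists x y, [/\ `|x| <= 1, `|y| <= 1 & 1 - e < F (t x y)].
Proof.
move=> F1 e0; apply: contrapT => nF.
have ball x y : `|x| <= 1 -> `|y| <= 1 -> F (t x y) <= 1 - e.
  move=> x1 y1; rewrite leNgt; apply/negP => lt.
  by apply: nF; exists x, y.
(* The contrary assumption at the zero tensor supplies this bound. *)
have ze : 0 <= 1 - e.
  by rewrite -(linear0 F) -(tensor0l 0); apply: ball; rewrite normr0.
have Fxy x y : F (t x y) <= (1 - e) * (`|x| * `|y|).
  rewrite {1}(unitizeE x) {1}(unitizeE y) tensorZl tensorZr !functionalZ mulrA mulrC.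
  by rewrite ler_wpM2r ?mulr_ge0// ball// unitize_le1.
have Falg s d : 0 < d ->
    F (\sum_(p <- s) t p.1 p.2) <= (1 - e) * (`|\sum_(p <- s) t p.1 p.2| + d).
  move=> d0; rewrite tnorm functional_sum.
  have [|s' /(_ _ (functional_tensor_bilinear F)) -> lt] :=
    @projective_norm_lt _ _ _ s (projective_norm s + d); first by rewrite ltrDl.
  apply: (@le_trans _ _ (\sum_(p <- s') (1 - e) * (`|p.1| * `|p.2|))).
    exact: ler_sum.
  by rewrite -mulr_sumr ler_wpM2l// ltW.
have Fall q : F q <= (1 - e) * `|q|.
  apply/ler_addgt0Pr => r r0.
  have r3 : 0 < r / 3 by rewrite divr_gt0.
  have [s] := tensor_dense q r3; set a := \sum_(p <- s) _ => qa.
  have h1 := Falg s _ r3; rewrite -/a in h1.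
  have h2 : F q - F a <= `|q - a|.
    by rewrite -functionalB (le_trans (functional_le _ _))// F1 mul1r.
  have h3 : `|a| <= `|q| + `|q - a|.
    by rewrite -lerBlDl distrC lerB_dist.
  have h4 : (1 - e) * (`|a| + r / 3) <= (1 - e) * (`|q| + r / 3 + r / 3).
    rewrite ler_wpM2l//; move: h3 qa; move: `|a| `|q| `|q - a|.
    by clear => *; lra.
  have h5 : (1 - e) * (r / 3 + r / 3) <= r / 3 + r / 3.
    by rewrite ler_piMl//; lra.
  move: h1 h2 h4 h5 qa; rewrite -addrA mulrDr [in X in _ -> _ -> X]mulrDr.
  move: (F q) (F a) `|a| `|q| `|q - a| => A B C D G.
  by clear; move: ((1 - e) * D) => *; lra.
have [q q1] := dual_norm_approx F e0; rewrite F1 ltNge (le_trans (Fall q))//.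
by rewrite ler_piMr.
Qed.

End ProjectiveTensor.

(** The point is [t (a n) y0]. The loss [2 * e] bounds that of [(1 - e) * (1 - e)]; in [5 * e], two
    more come from exchanging [v] with a finite sum [v'] and one from the margin in [c]. *)
Lemma projective_tensor_daugavet_point (R : realType) (X Y : normedModType R)
    (P : completeNormedModType R) (t : X -> Y -> P) (F : dual P) (v : P) (e : R) :
  separable X -> L_embedded X -> daugavet X ->
  metric_approximation_property (bidual X) \/ metric_approximation_property Y ->
  is_projective_tensor_product t ->
  `|F| = 1 -> 0 < e -> e < 1 ->
  exists2 q, `|q| <= 1 & 1 - 2 * e <= F q /\ `|v| + 1 - 5 * e <= `|v + q|.
Proof.
move=> sepX LX dX MAP tP F1 e0 e1; have [tbil tnorm tdense] := tP.
have [x0 [y0 [x01 y01 Fxy]]] := tensor_slice_point tbil tnorm tdense F1 e0.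
have [Fl Fr] := functional_tensor_bilinear tbil F.
have [f0 f0E f01] : exists2 f0 : dual X, (forall x, f0 x = F (t x y0)) & `|f0| <= 1.
  apply: (@blin_of_bound R X R^o (fun x => F (t x y0)) 1 (Fl y0)) => // x.
  rewrite (le_trans (functional_tensor_le tnorm F x y0))// F1 !mul1r.
  by rewrite ler_piMr.
have [g gE g1] : exists2 g : dual Y, (forall y, g y = F (t x0 y)) & `|g| <= 1.
  apply: (@blin_of_bound R Y R^o (fun y => F (t x0 y)) 1 (Fr x0)) => // y.
  rewrite (le_trans (functional_tensor_le tnorm F x0 y))// F1 !mul1r.
  by rewrite ler_piMl.
have nf0 : 1 - e < `|f0|.
  by rewrite (lt_le_trans Fxy)// -f0E (le_trans (functional_le _ _))// ler_piMr.
have f0p : 0 < `|f0| by lra.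
pose f := `|f0|^-1 *: f0.
have f1 : `|f| = 1 by rewrite normrZ normfV normr_id mulVf ?gt_eqF.
have [U [UU ooU]] := ultraFilterLemma eventually_filter.
have [a [z [a1 fa z1 zE orth]]] :=
  separable_daugavet_Lorthogonal UU ooU sepX dX f1 e0.
have [pr [pz [prl pzl prn prE prz]]] := L_embedded_projection LX.
have [prz0 pzz] := prz z z1 orth.
have zf : 1 - e <= z f.
  rewrite zE; apply: (@ulim_ge_near R U UU _ 1); last exact: filterE.
  by move=> n; rewrite (le_trans (blin_norm_le _ _))// f1 mul1r.
have [L vL] := tensor_dense tdense v e0.
set v' := \sum_(p <- L) _ in vL.
have [G [G1 Gv]] := norming_functional v'.
have [Gl Gr] := functional_tensor_bilinear tbil G.
(* Contractive because each term is controlled by one component of [u], and the norms of the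
   components add up to [|u|]. *)
pose B (u : bidual X) (y : Y) : R := G (t (pr u) y) + pz u f * g y.
have Bc : contractive_form B.
  split; first split=> [y k u w|u k y w].
  - rewrite /B prl pzl Gl dualD dualZ mulrDl.
    by rewrite [k *: (_ + _)]scalerDr addrACA -mulrA.
  - rewrite /B Gr functionalD functionalZ mulrDr mulrCA.
    by rewrite [k *: (_ + _)]scalerDr addrACA.
  - move=> u y; rewrite (le_trans (ler_normD _ _))// prn mulrDl lerD//.
      rewrite (le_trans (functional_tensor_le tnorm _ _ _))//.
      by rewrite ler_piMl// mulr_ge0.
    rewrite normrM ler_pM//.
      by rewrite (le_trans (blin_norm_le _ _))// f1 mulr1.
    by rewrite (le_trans (blin_norm_le _ _))// ler_piMl.
have e20 : 0 < e / 2 by rewrite divr_gt0.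
pose M := (z, y0) :: [seq (bidual_embedding q.1, q.2) | q <- L].
have [s [s1 sM]] := form_approx M Bc MAP e20.
(* At [(z, y0)] the first term vanishes and the second is [z f * g y0], both factors being at least
   [1 - e]; on [L] only [G] contributes, giving [|v'|]. *)
have BM : `|v'| + (1 - e) * (1 - e) <= \sum_(q <- M) B q.1 q.2.
  rewrite big_cons big_map /= addrC lerD//.
    rewrite /B prz0 pzz.
    rewrite (tensor0l tbil) [G 0]linear0.
    by rewrite add0r gE ler_pM ?subr_ge0 ?(ltW e1)// ltW.
  rewrite -Gv /v' functional_sum; apply: ler_sum => q _.
  by rewrite /B (prE _).1 (prE _).2 [(0 : bidual X) f]/(0) mul0r addr0.
(* The approximation of [B] lost [e / 2]; the larger margin [e] makes the contradiction strict. *)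
pose c := `|v'| + (1 - e) * (1 - e) - e.
have [n cn] : exists n, c <= projective_norm ((a n, y0) :: L).
  apply: contrapT => nc.
  have lt n : projective_norm ((a n, y0) :: L) < c.
    by rewrite ltNge; apply/negP => le; apply: nc; exists n.
  have := finite_type_form_ulim UU s1 a1 zE lt.
  rewrite -/M; move: BM sM; rewrite /c; move: (\sum_(q <- M) B _ _) => A1.
  move: (\sum_(q <- M) _) `|v'| => A2 A3.
  by move: e0; clear; lra.
exists (t (a n) y0).
  by rewrite (le_trans (tensor_norm_le tnorm _ _))// mulr_ile1.
split.
  have : `|f0| * (1 - e) <= `|f0| * f (a n) by rewrite ler_wpM2l.
  rewrite /f dualZ mulrA mulfV ?gt_eqF// mul1r f0E.
  have : (1 - e) * (1 - e) <= `|f0| * (1 - e).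
    by rewrite ler_wpM2r ?subr_ge0 ?(ltW e1) ?(ltW nf0).
  by move: `|f0| (F _) => A1 A2; clear; nra.
move: cn; rewrite -tnorm big_cons /= -/v' /c.
have : `|v| <= `|v'| + `|v - v'|.
  by rewrite -{1}(subrK v' v) addrC (le_trans (ler_normD _ _)).
have : `|t (a n) y0 + v'| <= `|v + t (a n) y0| + `|v - v'|.
  have -> : t (a n) y0 + v' = (v + t (a n) y0) - (v - v').
    by rewrite opprB [v + _]addrC -addrA [v + (v' - v)]addrC subrK.
  exact: ler_normB.
move: vL; move: `|v - v'| `|v'| `|v + _| `|v| `|_ + v'|.
by move=> A1 A2 A3 A4 A5; clear; nra.
Qed.

(** [T] is written [q |-> G q *: w] with [|G| = 1]. At a point [q] with [G q] close to [1],
    [(T + I) q] is close to [w + q], whose norm is almost [|w| + 1]. *)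
Lemma projective_tensor_daugavet (R : realType) (X Y : normedModType R)
    (P : completeNormedModType R) (t : X -> Y -> P) :
  separable X -> L_embedded X -> daugavet X ->
  metric_approximation_property (bidual X) \/ metric_approximation_property Y ->
  is_projective_tensor_product t -> daugavet P.
Proof.
move=> sepX LX dX MAP tP T [v v0 rT].
have nv : 0 < `|v| by rewrite normr_gt0.
have /choice[F0 TF] : forall q, exists a, T q = a *: v.
  move=> q; have : range T (T q) by exists q.
  by rewrite rT => -[a _ <-]; exists a.
have vI a b : a *: v = b *: v -> a = b.
  move=> /eqP; rewrite -subr_eq0 -scalerBl scaler_eq0 (negbTE v0) orbF.
  by rewrite subr_eq0 => /eqP.
have F0lin : linear (F0 : P -> R^o).
  move=> k p q; apply: vI; rewrite -TF blin_linear !TF scalerDl.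
  by rewrite -[k *: F0 p]/(k * F0 p) -scalerA.
have [F FE _] : exists2 F : dual P, (forall q, F q = F0 q) & `|F| <= `|T| / `|v|.
  apply: (@blin_of_bound R P R^o F0 _ F0lin) => [|q]; first by rewrite divr_ge0.
  by rewrite mulrAC ler_pdivlMr// -normrZ -TF blin_norm_le.
have TFE q : T q = F q *: v by rewrite TF FE.
have nF : 0 < `|F|.
  rewrite normr_gt0; apply/eqP => F0E.
  have [q _ Tq] : range T v by rewrite rT; exists 1 => //; rewrite scale1r.
  move: Tq; rewrite TFE F0E [(0 : dual P) q]/(0) scale0r => /esym/eqP.
  by rewrite (negbTE v0).
pose G := `|F|^-1 *: F.
have G1 : `|G| = 1 by rewrite normrZ normfV normr_id mulVf ?gt_eqF.
pose w := `|F| *: v.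
have TG q : T q = G q *: w.
  by rewrite TFE scalerA /G dualZ mulrAC mulVf ?gt_eqF// mul1r.
have Tw : `|T| <= `|w|.
  apply: opnorm_le => q q1; rewrite TG normrZ ler_piMl//.
  by rewrite (le_trans (blin_norm_le _ _))// G1 mul1r.
have I1 : `|blin_id P| <= 1 by exact: opnorm_le.
apply/le_anti/andP; split.
  by rewrite (le_trans (ler_normD _ _))// addrC lerD2r.
apply: (@le_trans _ _ (1 + `|w|)); first by rewrite lerD2l.
apply/ler_addgt0Pr => r r0.
pose N := `|w|.
have N0 : 0 <= N by exact: normr_ge0.
(* The total loss is [5 * e] from the point [q] plus [2 * e * N] from replacing [G q] by [1]. *)
pose e := Num.min (1 / 2) (r / (2 * N + 5)).
have d0 : 0 < 2 * N + 5 by lra.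
have e0 : 0 < e by rewrite lt_min !divr_gt0.
have e12 : e <= 1 / 2 by rewrite ge_min lexx.
have er : e * (2 * N + 5) <= r by rewrite -ler_pdivlMr// ge_min lexx orbT.
have e1 : e < 1 by lra.
have [q q1 [Gq wq]] := projective_tensor_daugavet_point w sepX LX dX MAP tP G1 e0 e1.
have Gq1 : G q <= 1 by rewrite (le_trans (functional_le _ _))// G1 mul1r.
have h1 : `|(T + blin_id P) q| <= `|T + blin_id P|.
  by rewrite (le_trans (blin_norm_le _ _))// ler_piMr.
have h2 : `|w + q| <= `|(T + blin_id P) q| + 2 * e * N.
  have -> : w + q = (T + blin_id P) q + (1 - G q) *: w.
    rewrite blinD TG /= scalerBl scale1r [G q *: w + _]addrC -addrA.
    by rewrite [G q *: w + (w - _)]addrC subrK addrC.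
  rewrite (le_trans (ler_normD _ _))// lerD2l normrZ ler_wpM2r//.
  by rewrite ger0_norm ?subr_ge0//; lra.
move: wq h1 h2 er; rewrite -/N; move: `|w + q| `|_ q| `|_ + _| => A1 A2 A3.
by clear; nra.
Qed.

Theorem theorem3p7 (R : realType) (X Y : completeNormedModType R)
    (P : completeNormedModType R) (t : X -> Y -> P) :
  separable X ->
  L_embedded X ->
  daugavet X ->
  (exists y : Y, y != 0) ->
  metric_approximation_property (bidual X) \/
    metric_approximation_property Y ->
  is_projective_tensor_product t ->
  daugavet P.
Proof.
move=> sepX LX dX _ MAP tP.
exact: projective_tensor_daugavet sepX LX dX MAP tP.
Qed.
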